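(* Assume the closure operator $\mathrm{cl}$ is finitary. Then the map $D\mapsto F_D$ is an order embedding of $(\overline{\mathbf D},\subseteq)$ into the partially ordered set $(\overline{\mathbf F}_{\mathrm{fin}},\subseteq)$ of all finitely coherent SDFSes; its image is exactly the set of all conjunctive finitely coherent SDFSes, and on this image its inverse is the map $F\mapsto D_F$.
   Context: Let $\mathcal T$ be a non-empty set (of ''things''). Let $\mathrm{cl}:\mathcal P(\mathcal T)\to\mathcal P(\mathcal T)$ be a closure operator (extensive, monotone, idempotent); it is finitary if $\mathrm{cl}(A)=\bigcup\{\mathrm{cl}(F):F\subseteq A,\ F\text{ finite}\}$ for all $A\subseteq\mathcal T$. Let $\mathcal T_-\subseteq\mathcal T$ be a set of forbidden things and $\mathcal T_+:=\mathrm{cl}(\emptyset)$; standing assumption: $\mathcal T_+\cap\mathcal T_-=\emptyset$. A coherent SDT is a $D\subseteq\mathcal T$ with $\mathrm{cl}(D)=D$ and $D\cap\mathcal T_-=\emptyset$; $\overline{\mathbf D}$ is the set of all coherent SDTs. $\mathcal Q(\mathcal T)$ denotes the set of all finite subsets of $\mathcal T$ (including $\emptyset$). For $\mathcal V\subseteq\mathcal P(\mathcal T)$, $\Sigma_{\mathcal V}$ is the set of maps $\sigma:\mathcal V\to\mathcal T$ with $\sigma(A)\in A$ for all $A\in\mathcal V$, and $\sigma(\mathcal V):=\{\sigma(A):A\in\mathcal V\}$. An SDFS is any $F\subseteq\mathcal Q(\mathcal T)$. It is finitely coherent if (F1) $\emptyset\notin F$; (F2) if $A_1\in F$ and $A_1\subseteq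 A_2\in\mathcal Q(\mathcal T)$ then $A_2\in F$; (F3) if $A\in F$ then $A\setminus\mathcal T_-\in F$; (F4) $\{t\}\in F$ for all $t\in\mathcal T_+$; (F5) for every non-empty finite $\mathcal V\subseteq F$ and every family $(t_\sigma)_{\sigma\in\Sigma_{\mathcal V}}$ with $t_\sigma\in\mathrm{cl}(\sigma(\mathcal V))$, $\{t_\sigma:\sigma\in\Sigma_{\mathcal V}\}\in F$. An SDFS $F$ is conjunctive if for all $A\in F$ there is $t\in A$ with $\{t\}\in F$. For $D\subseteq\mathcal T$ let $F_D:=\{A\in\mathcal Q(\mathcal T):A\cap D\neq\emptyset\}$, and for an SDFS $F$ let $D_F:=\{t\in\mathcal T:\{t\}\in F\}$. An order embedding is a map $f$ with $x\le y\iff f(x)\le f(y)$. *)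

(* Defs.v *)
From mathcomp Require Import all_boot.
From mathcomp Require Import boolp classical_sets functions cardinality.

Set Implicit Arguments.
Unset Strict Implicit.
Unset Printing Implicit Defensive.

Local Open Scope classical_set_scope.

Definition closure_operator (T : Type) (cl : set T -> set T) : Prop :=
  [/\ forall A, A `<=` cl A,
      forall A B, A `<=` B -> cl A `<=` cl B &
      forall A, cl (cl A) = cl A].

Definition finitary (T : Type) (cl : set T -> set T) : Prop :=
  forall A, cl A = \bigcup_(G in [set G | G `<=` A /\ finite_set G]) cl G.

Definition Tplus (T : Type) (cl : set T -> set T) : set T := cl set0.

Definition coherent_SDT (T : Type) (cl : set T -> set T) (Tminus : set T) :
    set (set T) :=
  [set D | cl D = D /\ D `&` Tminus = set0].

Definition Q (T : Type) : set (set T) := [set A | finite_set A].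
Arguments Q : clear implicits.

(* The selection maps have domain exactly V (the type of members of V), so that
   families indexed by [selections V] cannot depend on values outside V. *)
Definition selections (T : Type) (V : set (set T)) : set (V -> T) :=
  [set sigma | forall A : V, set_val A (sigma A)].
Arguments selections {T} V.

(* An SDFS is a set of finite sets, i.e. some F `<=` Q T; this inclusion is the
   first component. *)
Definition finitely_coherent (T : Type) (cl : set T -> set T)
    (Tminus : set T) : set (set (set T)) :=
  [set F |
    F `<=` Q T /\
    [/\ ~ F set0,
        forall A1 A2, F A1 -> A1 `<=` A2 -> Q T A2 -> F A2,
        forall A, F A -> F (A `\` Tminus),
        forall t, Tplus cl t -> F [set t] &
        forall V : set (set T), V !=set0 -> finite_set V -> V `<=` F ->
        forall t : selections V -> T,
          (forall sigma, cl (range (set_val sigma)) (t sigma)) ->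
          F (range t)]].

Definition conjunctive (T : Type) (F : set (set T)) : Prop :=
  forall A, F A -> exists2 t, A t & F [set t].

Definition SDFS_of (T : Type) (D : set T) : set (set T) :=
  [set A | Q T A /\ A `&` D !=set0].

Definition SDT_of (T : Type) (F : set (set T)) : set T :=
  [set t | F [set t]].

Definition order_embedding (X Y : Type) (P : set X) (leX : X -> X -> Prop)
    (P' : set Y) (leY : Y -> Y -> Prop) (f : X -> Y) : Prop :=
  (forall x, P x -> P' (f x)) /\
  (forall x y, P x -> P y -> (leX x y <-> leY (f x) (f y))).

Definition inverse_between (X Y : Type) (P : set X) (P' : set Y)
    (f : X -> Y) (g : Y -> X) : Prop :=
  [/\ forall y, P' y -> P (g y),
      forall x, P x -> g (f x) = x &
      forall y, P' y -> f (g y) = y].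

(* Main.v *)
(**
   A finite family V of sets meeting a coherent D admits a selection with values
   in D, and closedness of D puts the corresponding t_sigma in D; this gives (F5)
   for F_D.  Conversely, if {g} is in F for each g in a non-empty finite set G,
   then the family of these singletons has only one selection, with image G, so
   (F5) puts {t} in F for each t in cl(G); as cl is finitary, this (with (F4)
   when G is empty) makes D_F closed.  The remaining claims are set algebra.
*)
Require Import Defs.
From mathcomp Require Import all_boot.
From mathcomp Require Import boolp classical_sets functions cardinality.

Local Open Scope classical_set_scope.

(** Once [A] is enumerated by a sequence [s], each subset is cut out of [s] by a boolean mask, and
    there are finitely many masks of length [size s]. *)
Lemma finite_powerset (T : Type) (A : set T) :
  finite_set A -> finite_set [set B | B `<=` A].
Proof.
move=> /(@finite_seqP {classic T})[s ->].
pose f (m : (size s).-tuple bool) : set T := [set` mask m s].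
apply: (@sub_finite_set _ _ (range f)); last first.
  exact/finite_image/finite_finset.
move=> B sB; exists (map_tuple (fun x : {classic T} => `[< B x >]) (in_tuple s)).
  by [].
rewrite /f /= -filter_mask; apply/seteqP; split => x /=.
  by rewrite mem_filter => /andP[/asboolP].
by move=> Bx; rewrite mem_filter sB // andbT; exact/asboolP.
Qed.

(** A selection is determined by its graph, a subset of the finite set [V]*[W] with [W] the union of
    [V]. This makes the sets [range t] of (F5) finite, hence members of [Q T]. *)
Lemma finite_selections (T : Type) (V : set (set T)) :
  finite_set V -> V `<=` Q T -> finite_set [set: selections V].
Proof.
move=> finV VQ.
pose graph (sigma : selections V) : set (set T * T) :=
  range (fun A : V => (val A, val sigma A)).
have graph_inj : injective graph.
  move=> s1 s2 eq_graph; apply: val_inj; apply: funext => A.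
  have : graph s1 (val A, val s1 A) by exists A.
  by rewrite eq_graph => -[A' _ [/val_inj -> /esym]].
pose W := \bigcup_(A in V) A.
have finVW : finite_set (V `*` W).
  by apply: finite_setX => //; apply: bigcup_finite.
have graph_inj_in : {in graph @^-1` [set B | B `<=` V `*` W] &, injective graph}.
  by move=> s1 s2 _ _; exact: graph_inj.
apply: sub_finite_set (finite_preimage graph_inj_in (finite_powerset _ _ finVW)).
move=> sigma _ _ [A _ <-]; split => /=; first exact: set_valP.
by exists (val A); [exact: set_valP | exact: (set_valP sigma A)].
Qed.

Lemma exists_selection_in (T : Type) (V : set (set T)) (D : set T) :
  V `<=` SDFS_of D -> exists sigma : selections V, range (set_val sigma) `<=` D.
Proof.
move=> VD.
have /choice[s sP] : forall A : V, exists t, (val A `&` D) t.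
  by move=> A; have [] := VD _ (set_valP A).
have sel_s : selections V s by move=> A; have [] := sP A.
exists (SigSub (mem_set sel_s)) => _ [A _ <-].
by have [] := sP A.
Qed.

Lemma finitely_coherent_SDFS_of (T : Type) (cl : set T -> set T)
    (Tminus D : set T) :
  closure_operator cl -> coherent_SDT cl Tminus D ->
  finitely_coherent cl Tminus (SDFS_of D).
Proof.
move=> [_ cl_mono _] [clD DTminus]; split; first by move=> A [].
split.
- by case=> _ [t []].
- move=> A1 A2 [_ [t [A1t Dt]]] sA12 finA2; split => //.
  by exists t; split => //; exact: sA12.
- move=> A [finA [t [At Dt]]]; split; first exact: finite_setD.
  exists t; split => //; split => // Tt.
  by have : (D `&` Tminus) t by []; rewrite DTminus.
- move=> t Tt; split; first exact: finite_set1.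
  by exists t; split => //; rewrite -clD; exact: cl_mono Tt.
move=> V _ finV VF t tP; split.
  by apply/finite_image/finite_selections => // A /VF[].
(* For a selection with values in [D], monotonicity gives [t sigma] in [cl D = D], so [range t]
   meets [D]. *)
have [sigma sD] := exists_selection_in _ _ _ VF.
exists (t sigma); split; first by exists sigma.
by rewrite -clD; exact: cl_mono (tP sigma).
Qed.

Lemma SDFS_ofK (T : Type) (D : set T) : SDT_of (SDFS_of D) = D.
Proof.
apply/seteqP; split => [t [_ [_ [-> //]]] | t Dt].
by split; [exact: finite_set1 | exists t].
Qed.

Lemma SDT_of_sub (T : Type) (F1 F2 : set (set T)) :
  F1 `<=` F2 -> SDT_of F1 `<=` SDT_of F2.
Proof. by move=> sF t; exact: sF. Qed.

Lemma SDFS_of_sub (T : Type) (D1 D2 : set T) :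
  D1 `<=` D2 -> SDFS_of D1 `<=` SDFS_of D2.
Proof. by move=> sD A [finA [t [At /sD]]]; split => //; exists t. Qed.

Lemma conjunctive_SDFS_of (T : Type) (D : set T) : conjunctive (SDFS_of D).
Proof.
move=> A [_ [t [At Dt]]]; exists t => //.
by split; [exact: finite_set1 | exists t].
Qed.

Lemma SDT_ofK (T : Type) (cl : set T -> set T) (Tminus : set T)
    (F : set (set T)) :
  finitely_coherent cl Tminus F -> conjunctive F -> SDFS_of (SDT_of F) = F.
Proof.
move=> [FQ [_ F2 _ _ _]] conjF; apply/seteqP; split => [A [finA [t [At Ft]]]|A FA].
  by apply: F2 Ft _ finA => _ ->.
by split; [exact: FQ | have [t] := conjF _ FA; exists t].
Qed.

Lemma cl_SDT_of_finite (T : Type) (cl : set T -> set T) (Tminus G : set T)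
    (F : set (set T)) :
  finitely_coherent cl Tminus F -> finite_set G -> G `<=` SDT_of F ->
  cl G `<=` SDT_of F.
Proof.
move=> [_ [_ _ _ F4 F5]] finG GF t clGt.
have [G0|/set0P[g Gg]] := eqVneq G set0; first by apply: F4; rewrite /Tplus -G0.
pose V := [set [set x] | x in G].
have VP (x : T) : G x -> V [set x] by exists x.
(* On a singleton a selection has no freedom, so it picks out all of [G]. *)
have range_sel (sigma : selections V) : range (set_val sigma) = G.
  apply/seteqP; split => [_ [A _ <-]|x Gx].
    have [x Gx xA] := set_valP A.
    have : val A (val sigma A) := set_valP sigma A.
    by rewrite -xA => sAx; rewrite -[set_val sigma A]/(val sigma A) sAx.
  exists (SigSub (mem_set (VP x Gx))) => //.
  exact: (set_valP sigma (SigSub (mem_set (VP x Gx)))).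
(* A selection must exist: otherwise the constant family at [t] would have empty range instead of
   [[set t]]. *)
have VD : V `<=` SDFS_of G.
  move=> _ [x Gx <-]; split; first exact: finite_set1.
  by exists x.
have [sigma0 _] := exists_selection_in _ _ _ VD.
rewrite /SDT_of /=; have <- : range (fun _ : selections V => t) = [set t].
  by apply/seteqP; split => [_ [_ _ <-]//|_ ->]; exists sigma0.
apply: F5.
- by exists [set g]; exact: VP.
- exact: finite_image.
- by move=> _ [x Gx <-]; exact: GF.
- by move=> sigma; rewrite range_sel.
Qed.

Lemma coherent_SDT_of (T : Type) (cl : set T -> set T) (Tminus : set T)
    (F : set (set T)) :
  closure_operator cl -> finitary cl -> finitely_coherent cl Tminus F ->
  coherent_SDT cl Tminus (SDT_of F).
Proof.
move=> [cl_ext _ _] cl_fin cohF; split; apply/seteqP; split => //.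
- rewrite cl_fin => t [G [GF finG]].
  exact: (cl_SDT_of_finite _ _ _ _ _ cohF).
- have [_ [F1 _ F3 _ _]] := cohF.
  move=> t [Ft Tt]; apply: F1.
  (* If [t] were forbidden, (F3) applied to [[set t]] would put the empty set in [F], against
     (F1). *)
  suff <- : [set t] `\` Tminus = set0 by exact: F3.
  by apply/seteqP; split => // _ [->].
Qed.

Theorem theorem2 (T : Type) (T_nonempty : [set: T] !=set0)
    (cl : set T -> set T) (Tminus : set T)
    (cl_closure : closure_operator cl)
    (Tplus_Tminus : Tplus cl `&` Tminus = set0)
    (cl_finitary : finitary cl) :
  [/\ order_embedding (coherent_SDT cl Tminus) (@subset T)
        (finitely_coherent cl Tminus) (@subset (set T)) (@SDFS_of T),
      @SDFS_of T @` coherent_SDT cl Tminus =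
        [set F | finitely_coherent cl Tminus F /\ conjunctive F] &
      inverse_between (coherent_SDT cl Tminus)
        (@SDFS_of T @` coherent_SDT cl Tminus) (@SDFS_of T) (@SDT_of T)].
Proof.
split.
- split=> [D|D1 D2 _ _]; first exact: finitely_coherent_SDFS_of.
  split; first exact: SDFS_of_sub.
  (* Order is reflected because the left inverse [SDT_of] is itself monotone. *)
  by move=> /SDT_of_sub; rewrite !SDFS_ofK.
- apply/seteqP; split => [_ [D cohD <-]|F [cohF conjF]].
    split; first exact: finitely_coherent_SDFS_of.
    exact: conjunctive_SDFS_of.
  exists (SDT_of F); first exact: coherent_SDT_of.
  exact: (SDT_ofK _ cl Tminus).
(* Elements of the image have the form [SDFS_of D], so all three claims reduce to the left-inverse
   identity. *)
- split=> [_ [D cohD <-]|D _|_ [D _ <-]]; by rewrite SDFS_ofK.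
Qed.
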